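(* Let $d\ge2$, $N,M\ge1$ be integers and $|\psi\rangle,|\phi\rangle\in\mathbb{C}^d$ unit vectors with $|\langle\psi|\phi\rangle|^2=c\in(0,1)$. The mean square error $v_{ee}(c)=\mathbb{E}[(w-c)^2]$ of the estimate-and-estimate strategy, whose estimator is the overlap $w=|\langle\phi_V|\psi_W\rangle|^2$ of the two estimated states, is $$v_{ee}(c)=\frac{(d+M+N)\left[\left(2+c(cd-2)(d+1)\right)(d+M+N+1)+2c(1-c)MN\right]}{(d+M)(d+M+1)(d+N)(d+N+1)} .$$ Moreover, as $M\to\infty$ with $N$ fixed, $v_{ee}(c)\to\frac{2+c(d+1)(cd-2)+2c(1-c)N}{(d+N)(d+N+1)}$, which is $\frac{2c(1-c)}{N}+\mathcal{O}(N^{-2})$ for large $N$; and $v_{ee}(c)\sim\frac{8c(1-c)}{M+N}$ as $M+N\to\infty$ with $M-N$ fixed.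
   Context: Estimate-and-estimate strategy: independent covariant measurements are performed on $|\phi\rangle^{\otimes M}$ and on $|\psi\rangle^{\otimes N}$, producing estimates $|\phi_V\rangle=V|0\rangle$ and $|\psi_W\rangle=W|0\rangle$, $V,W\in SU(d)$, with joint probability density $$\binom{M+d-1}{d-1}|\langle\phi_V|\phi\rangle|^{2M}\binom{N+d-1}{d-1}|\langle\psi_W|\psi\rangle|^{2N}$$ with respect to the product $dV\,dW$ of normalized Haar measures ($|0\rangle$ a fixed unit vector). *)

(* Defs.v *)
From HB Require Import structures.
From mathcomp Require Import all_boot all_order all_algebra.
From mathcomp Require Import spectral complex.
From mathcomp Require Import all_classical all_reals all_analysis.

Set Implicit Arguments.
Unset Strict Implicit.
Unset Printing Implicit Defensive.

Import Order.TTheory GRing.Theory Num.Theory Num.Def.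
Import numFieldNormedType.Exports.

Local Open Scope classical_set_scope.
Local Open Scope ring_scope.
Local Open Scope sesquilinear_scope.

(* R[i] has no topology of its own; seen as an abstract numClosedFieldType it
   gets the one induced by its norm. *)
Definition Cplx (R : realType) : numClosedFieldType := R[i]%C.

Section Hilbert.
Variables (R : realType) (d : nat).
Implicit Types u v : 'cV[Cplx R]_d.

Definition braket u v : Cplx R := (u^t* *m v) 0 0.

Definition unit_vector u : Prop := braket u u = 1.

(* The modulus |<u|v>|, as an element of R. *)
Definition overlap u v : R := Normc.normc (braket u v).

End Hilbert.

Section SpecialUnitary.
Variables (R : realType) (d : nat).

Definition SUset : set 'M[Cplx R]_d := [set U | U \is unitarymx /\ \det U = 1].

Definition SU_type : Type := SUset.

Lemma SUset1 : SUset 1%:M.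
Proof.
split; last by rewrite det1.
by apply/unitarymxP; rewrite trmx1 map_mx1 mulmx1.
Qed.

Lemma SUsetM U V : SUset U -> SUset V -> SUset (U *m V).
Proof.
move=> [uU dU] [uV dV]; split; first exact: mul_unitarymx.
by rewrite det_mulmx dU dV mulr1.
Qed.

Definition SU1 : SU_type := exist _ 1%:M (mem_set SUset1).

HB.instance Definition _ := Choice.on SU_type.
HB.instance Definition _ := isPointed.Build SU_type SU1.
(* The subspace topology of 'M_d. *)
HB.instance Definition _ := Topological.copy SU_type (set_type SUset).

(* SU(d) with its Borel sigma-algebra. *)
Definition SU := g_sigma_algebraType (@open SU_type).

Definition SU_mx (U : SU) : 'M[Cplx R]_d := set_val (U : SUset).

Definition SU_mul (U V : SU) : SU :=
  exist _ (SU_mx U *m SU_mx V)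
    (mem_set (SUsetM (set_valP (U : SUset)) (set_valP (V : SUset)))).

(* The preimage of A under V |-> U V is the translate U^-1 A. Regularity need
   not be required: it is automatic for Borel probability measures on the
   compact metrizable group SU(d). *)
Definition normalized_haar (mu : probability SU R) : Prop :=
  forall (U : SU) (A : set SU), measurable A -> mu (SU_mul U @^-1` A) = mu A.

End SpecialUnitary.

Section EstimateAndEstimate.
Variables (R : realType) (d : nat) (mu : probability (SU R d) R).
Variable ket0 : 'cV[Cplx R]_d.

Definition estimate (V : SU R d) : 'cV[Cplx R]_d := SU_mx V *m ket0.

(* The density, with respect to mu, of the outcome of the covariant measurement
   on n copies of chi. *)
Definition covariant_density (n : nat) (chi : 'cV[Cplx R]_d) (V : SU R d) : R :=
  'C(n + d - 1, d - 1)%:R * overlap (estimate V) chi ^+ (2 * n).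

Variables phi psi : 'cV[Cplx R]_d.

Definition joint_density (M N : nat) (p : SU R d * SU R d) : R :=
  covariant_density M phi p.1 * covariant_density N psi p.2.

Definition ee_expectation (M N : nat) (X : SU R d * SU R d -> R) : \bar R :=
  (\int[mu \x mu]_p (X p * joint_density M N p)%:E)%E.

Definition ee_estimator (p : SU R d * SU R d) : R :=
  overlap (estimate p.1) (estimate p.2) ^+ 2.

Definition ee_mse (M N : nat) : \bar R :=
  ee_expectation M N (fun p => (ee_estimator p - overlap psi phi ^+ 2) ^+ 2).

End EstimateAndEstimate.

(* Main.v *)
Require Import Defs.
From mathcomp Require Import all_boot all_order all_algebra.
From mathcomp Require Import cyclic separable cyclotomic.
From mathcomp Require Import spectral complex.
From mathcomp Require Import all_classical all_reals all_analysis.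
From mathcomp Require Import measurable_realfun ring zify.

(** Write z = V|0> for the estimated state.  By left invariance the moment
    E|<z|u>|^(2n) depends on u only through its norm, so it equals
    m_n |u|^(2n): a complex Householder reflection maps any unit vector to any
    other, and its determinant is corrected by a global phase, which the modulus
    does not see.  Averaging this identity for u = phi + r w^k psi over the
    powers of a root of unity w of order > n keeps only the terms that are
    diagonal in the two amplitudes; comparing coefficients of r^2 gives all joint
    moments E[|<z|phi>|^(2M) |<z|psi>|^(2j)] in terms of m_(M+j), and summing the
    case j = 1 over an orthonormal basis gives the recursion that determines m_n.
    By Tonelli, the mean square error is then obtained by applying the moments
    of order j <= 2 twice: first over W, with psi measured against the fixed
    state phi_V, then over V.  The asymptotic statements follow by viewing the
    resulting rational function as a function of 1/M or of 1/(M+N). *)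

Set Implicit Arguments.
Unset Strict Implicit.
Unset Printing Implicit Defensive.

Import Order.TTheory GRing.Theory Num.Theory.
Import numFieldNormedType.Exports.

Local Open Scope classical_set_scope.
Local Open Scope ring_scope.

(** * Roots of unity and coefficient extraction *)

(** In characteristic 0 the polynomial X^n - 1 is separable, so it has n distinct roots; n distinct
    n-th roots of unity in a field form a cyclic group, and a generator is primitive. *)
Lemma primitive_root_exists (C : numClosedFieldType) (n : nat) :
  (0 < n)%N -> exists w : C, n.-primitive_root w.
Proof.
move=> n_gt0.
have [r rE] := closed_field_poly_normal ('X^n - 1 : {poly C}).
rewrite (monicP _) ?monicXnsubC // scale1r in rE.
have sz : size r = n by apply/eqP; rewrite -eqSS -(size_prod_XsubC r id) -rE size_XnsubC.
have Ur : uniq r.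
  by rewrite -separable_prod_XsubC -rE separable_Xn_sub_1 // pnatr_eq0 -lt0n.
have /hasP[w _ wP] : has n.-primitive_root r.
  rewrite has_prim_root ?sz //; apply/allP => x xr.
  by rewrite -root_prod_XsubC -rE in xr.
by exists w.
Qed.

Section RootsOfUnity.
Variables (C : numClosedFieldType) (K : nat) (w : C).
Hypothesis wP : K.-primitive_root w.

Let K_gt0 : (0 < K)%N. Proof. exact: prim_order_gt0 wP. Qed.

Let w_conj : w^* = w^-1.
Proof.
have w1 : `|w| = 1.
  apply/eqP; rewrite -(pexpr_eq1 K_gt0) // -normrX (prim_expr_order wP).
  by rewrite normr1.
by rewrite invC_norm w1 expr1n invr1 mul1r.
Qed.

(** Since w has modulus 1, conjugation inverts it and the terms are the powers of z = w^i / w^j. For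
    i and j below K, z equals 1 only if i = j; otherwise the geometric sum vanishes. *)
Lemma sum_root_orth (i j : nat) : (i < K)%N -> (j < K)%N ->
  \sum_(k < K) (w ^+ k) ^+ i * ((w ^+ k)^* ) ^+ j = (K * (i == j))%:R.
Proof.
move=> iK jK; have w0 : w != 0.
  apply: contra_eq_neq (prim_expr_order wP) => ->.
  by rewrite expr0n gtn_eqF // eq_sym oner_eq0.
pose z := w ^+ i / w ^+ j.
have zE (k : 'I_K) : (w ^+ k) ^+ i * ((w ^+ k)^* ) ^+ j = z ^+ k.
  by rewrite rmorphXn /= w_conj -!exprM ![(k * _)%N]mulnC !exprM -exprMn exprVn.
under eq_bigr do rewrite zE.
have [ij|ij] := eqVneq i j.
  rewrite /z ij divff ?expf_neq0 //; under eq_bigr do rewrite expr1n.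
  by rewrite sumr_const card_ord muln1.
have z1 : z - 1 != 0.
  rewrite subr_eq0; apply: contra ij => /eqP zE1.
  have /eqP : w ^+ i = w ^+ j by rewrite -(divfK (expf_neq0 j w0) (w ^+ i)) -/z zE1 mul1r.
  by rewrite (eq_prim_root_expr wP) !modn_small.
(* Multiplied by z - 1, the geometric sum telescopes to z^K - 1, which is 0. *)
apply: (mulfI z1); rewrite -subrX1 /z exprMn exprVn -!exprM ![(_ * K)%N]mulnC !exprM.
by rewrite (prim_expr_order wP) !expr1n invr1 mulr1 subrr muln0 mulr0.
Qed.

(** The 2n-th power of the modulus is the product of two binomial expansions, one of them
    conjugated. As n < K, every pair of exponents is within the range of [sum_root_orth], which
    kills the off-diagonal terms. *)
Lemma sum_normX_root (n : nat) (p q : C) : (n < K)%N ->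
  \sum_(k < K) `|p + w ^+ k * q| ^+ (2 * n)
  = K%:R * \sum_(j < n.+1)
      'C(n, j)%:R ^+ 2 * `|p| ^+ (2 * (n - j)) * `|q| ^+ (2 * j).
Proof.
move=> nK.
have E (k : 'I_K) : `|p + w ^+ k * q| ^+ (2 * n) =
   \sum_(i < n.+1) \sum_(j < n.+1) ('C(n, i)%:R * p ^+ (n - i) * q ^+ i)
    * ('C(n, j)%:R * p^* ^+ (n - j) * q^* ^+ j)
      * ((w ^+ k) ^+ i * ((w ^+ k)^* ) ^+ j).
  rewrite exprM normCK exprMn rmorphD rmorphM /= !exprDn mulr_suml.
  apply: eq_bigr => i _; rewrite mulr_sumr; apply: eq_bigr => j _.
  rewrite !exprMn -[_ *+ 'C(n, i)]mulr_natl -[_ *+ 'C(n, j)]mulr_natl.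
  move: (_ ^+ i) (_ ^+ i) (_ ^+ j) (_ ^+ j).
  move: (_ ^+ (n - i)) (_ ^+ (n - j)) 'C(n, i)%:R 'C(n, j)%:R => *; ring.
under eq_bigr do rewrite E.
rewrite exchange_big mulr_sumr; apply: eq_bigr => i _ /=.
rewrite exchange_big (bigD1 i) //= -mulr_sumr sum_root_orth ?(leq_trans _ nK) //.
rewrite big1 ?addr0 => [|j ji]; last first.
  rewrite -mulr_sumr sum_root_orth ?(leq_trans _ nK) //.
  by rewrite -val_eqE eq_sym in ji; rewrite (negPf ji) muln0 mulr0.
rewrite eqxx muln1 !exprM !normCK !exprMn.
move: (_ ^+ i) (_ ^+ i) (_ ^+ (n - i)) (_ ^+ (n - i)) 'C(n, i)%:R => *; ring.
Qed.

End RootsOfUnity.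

Lemma poly_eq_on_nat (R : numDomainType) (p q : {poly R}) :
  (forall n : nat, p.[n%:R] = q.[n%:R]) -> p = q.
Proof.
move=> pq; apply/eqP; rewrite -subr_eq0; apply/eqP.
apply: (@roots_geq_poly_eq0 _ _ [seq n%:R | n <- iota 0 (size (p - q))]).
- by apply/allP => _ /mapP[n _ ->]; rewrite /root !hornerE pq subrr.
- by rewrite map_inj_uniq ?iota_uniq // => a b /eqP; rewrite eqr_nat => /eqP.
- by rewrite size_map size_iota.
Qed.

(** An identity in y at all natural numbers is an identity of polynomials, so the coefficients of
    y^j agree. In its use y is the squared amplitude r^2, e i is a joint moment and m is the moment
    of a unit vector. *)
Lemma moment_coef (R : numFieldType) (M j : nat) (m x : R) (e : nat -> R) :
  (forall y : nat, \sum_(i < (M + j).+1) 'C(M + j, i)%:R ^+ 2 * e i * y%:R ^+ i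
   = m * \sum_(i < (M + j).+1) 'C(M + j, i)%:R * (y%:R * (1 - x)) ^+ (M + j - i)
      * \sum_(l < i.+1) 'C(i, l)%:R ^+ 2 * (y%:R * x) ^+ l) ->
  'C(M + j, j)%:R ^+ 2 * e j = m * \sum_(l < j.+1)
    'C(M + j, M + l)%:R * 'C(M + l, l)%:R ^+ 2 * (1 - x) ^+ (j - l) * x ^+ l.
Proof.
move=> H.
pose p : {poly R} := \sum_(i < (M + j).+1) ('C(M + j, i)%:R ^+ 2 * e i) *: 'X^i.
pose q : {poly R} := m *: \sum_(i < (M + j).+1) \sum_(l < i.+1)
   ('C(M + j, i)%:R * (1 - x) ^+ (M + j - i) * ('C(i, l)%:R ^+ 2 * x ^+ l))
    *: 'X^(M + j - i + l).
have pq : p = q.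
  apply: poly_eq_on_nat => y; rewrite /p /q !hornerE !horner_sum.
  under eq_bigr do rewrite !hornerE.
  rewrite H; congr (_ * _); apply: eq_bigr => i _.
  rewrite horner_sum mulr_sumr; apply: eq_bigr => l _.
  rewrite hornerZ hornerXn exprD [(_ * (1 - x)) ^+ _]exprMn [(_ * x) ^+ _]exprMn.
  move: (_ ^+ l) (_ ^+ l) (_ ^+ (M + j - i)) (_ ^+ (M + j - i)) => *; ring.
have := congr1 (fun u : {poly R} => u`_j) pq; rewrite /p /q coefZ !coef_sum.
rewrite (bigD1 (inord j)) //= big1 ?addr0; last first.
  move=> i; rewrite -val_eqE /= inordK ?ltnS ?leq_addl // => ij.
  by rewrite coefZ coefXn eq_sym (negPf ij) mulr0.
rewrite coefZ coefXn inordK ?ltnS ?leq_addl // eqxx mulr1 => ->.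
congr (_ * _).
rewrite -(big_mkord xpredT (fun i => (\sum_(l < i.+1)
   ('C(M + j, i)%:R * (1 - x) ^+ (M + j - i) * ('C(i, l)%:R ^+ 2 * x ^+ l))
    *: 'X^(M + j - i + l) : {poly R})`_j)).
(* The exponent of y is M + j - i + l. It exceeds j when i < M, so only the indices i = M + l' with
   l' at most j survive, and for each of them only l = l' contributes. *)
rewrite (big_cat_nat _ (n := M)) //= ?leqW ?leq_addr //.
rewrite [X in X + _]big_nat_cond big1 ?add0r => [|i /andP[/andP[_ iM] _]]; last first.
  rewrite coef_sum big1 // => l _; rewrite coefZ coefXn [_ == _](_ : _ = false) ?mulr0 //.
  lia.
rewrite -{1}[M]add0n big_addn -addnS addKn big_mkord; apply: eq_bigr => l _.
have lj := ltn_ord l; have lM : (l < (l + M).+1)%N by lia.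
rewrite coef_sum (bigD1 (Ordinal lM)) //= big1 ?addr0 => [|k]; last first.
  rewrite -val_eqE /= => kl; rewrite coefZ coefXn [_ == _](_ : _ = false) ?mulr0 //.
  lia.
rewrite coefZ coefXn (_ : _ == _ = true) ?mulr1; last by lia.
by rewrite (addnC l M) subnDl -[RHS]mulrA mulrA mulrAC; ring.
Qed.

(** * Bounded measurable functions and integration on SU(d) *)

Section BoundedMeasurable.
Context {disp : measure_display} {T : measurableType disp} {R : realType}.

(** These functions form an algebra and are integrable for every probability measure, so the
    integrability of all polynomial expressions below follows from closure properties alone. *)
Definition bmeasurable (f : T -> R) : Prop :=
  measurable_fun setT f /\ exists B, forall x, `|f x| <= B.

Lemma bmeasurable_cst (a : R) : bmeasurable (fun=> a).
Proof. by split; [exact: measurable_cst | exists `|a|]. Qed.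

Lemma bmeasurableD f g :
  bmeasurable f -> bmeasurable g -> bmeasurable (fun x => f x + g x).
Proof.
move=> [mf [B fB]] [mg [D gD]]; split; first exact: measurable_funD.
by exists (B + D) => x; rewrite (le_trans (ler_normD _ _)) ?lerD.
Qed.

Lemma bmeasurableM f g :
  bmeasurable f -> bmeasurable g -> bmeasurable (fun x => f x * g x).
Proof.
move=> [mf [B fB]] [mg [D gD]]; split; first exact: measurable_funM.
by exists (B * D) => x; rewrite normrM ler_pM.
Qed.

Lemma bmeasurableN f : bmeasurable f -> bmeasurable (fun x => - f x).
Proof.
move=> bf; have := bmeasurableM (bmeasurable_cst (-1)) bf.
by under eq_fun do rewrite mulN1r.
Qed.

Lemma bmeasurableX f n : bmeasurable f -> bmeasurable (fun x => f x ^+ n).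
Proof.
move=> bf; elim: n => [|n ihn]; first exact: bmeasurable_cst.
by under eq_fun do rewrite exprS; exact: bmeasurableM.
Qed.

Lemma bmeasurable_sum (I : Type) (r : seq I) (f : I -> T -> R) :
  (forall i, bmeasurable (f i)) -> bmeasurable (fun x => \sum_(i <- r) f i x).
Proof.
move=> bf; elim: r => [|i r ihr].
  by under eq_fun do rewrite big_nil; exact: bmeasurable_cst.
by under eq_fun do rewrite big_cons; exact: bmeasurableD.
Qed.

(** Going through real and imaginary parts avoids a sigma-algebra on the complex numbers. *)
Definition bmeasurableC (f : T -> Cplx R) : Prop :=
  bmeasurable (fun x => complex.Re (f x)) /\ bmeasurable (fun x => complex.Im (f x)).

Lemma bmeasurableC_cst (a : Cplx R) : bmeasurableC (fun=> a).
Proof. by split; exact: bmeasurable_cst. Qed.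

Lemma bmeasurableCD f g :
  bmeasurableC f -> bmeasurableC g -> bmeasurableC (fun x => f x + g x).
Proof.
have E (x : T) : (complex.Re (f x + g x) = complex.Re (f x) + complex.Re (g x)) *
   (complex.Im (f x + g x) = complex.Im (f x) + complex.Im (g x)).
  by case: (f x) (g x) => [a b] [a' b'].
move=> [rf jf] [rg jg]; split; under eq_fun do rewrite E; exact: bmeasurableD.
Qed.

Lemma bmeasurableCM f g :
  bmeasurableC f -> bmeasurableC g -> bmeasurableC (fun x => f x * g x).
Proof.
have E (x : T) : (complex.Re (f x * g x) =
     complex.Re (f x) * complex.Re (g x) + - (complex.Im (f x) * complex.Im (g x))) *
   (complex.Im (f x * g x) =
     complex.Re (f x) * complex.Im (g x) + complex.Im (f x) * complex.Re (g x)).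
  by case: (f x) (g x) => [a b] [a' b'].
move=> [rf jf] [rg jg]; split; under eq_fun do rewrite E;
  apply: bmeasurableD; try apply: bmeasurableN; exact: bmeasurableM.
Qed.

Lemma bmeasurableC_conj f : bmeasurableC f -> bmeasurableC (fun x => (f x)^*).
Proof.
have E (x : T) : (complex.Re (f x)^* = complex.Re (f x)) *
   (complex.Im (f x)^* = - complex.Im (f x)).
  by case: (f x) => a b.
by move=> [rf jf]; split; under eq_fun do rewrite E; [|exact: bmeasurableN].
Qed.

Lemma bmeasurableC_sum (I : Type) (r : seq I) (f : I -> T -> Cplx R) :
  (forall i, bmeasurableC (f i)) -> bmeasurableC (fun x => \sum_(i <- r) f i x).
Proof.
move=> bf; elim: r => [|i r ihr].
  by under eq_fun do rewrite big_nil; exact: bmeasurableC_cst.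
by under eq_fun do rewrite big_cons; exact: bmeasurableCD.
Qed.

(** The squared modulus is a polynomial in the real and imaginary parts, so no square root has to be
    measured; only even powers of overlaps occur later. *)
Lemma bmeasurable_normc2 f :
  bmeasurableC f -> bmeasurable (fun x => Normc.normc (f x) ^+ 2).
Proof.
have E (x : T) : Normc.normc (f x) ^+ 2 =
    complex.Re (f x) ^+ 2 + complex.Im (f x) ^+ 2.
  by case: (f x) => a b; rewrite /= sqr_sqrtr // addr_ge0 ?sqr_ge0.
by move=> [rf jf]; under eq_fun do rewrite E; apply: bmeasurableD; exact: bmeasurableX.
Qed.

Lemma bmeasurableC_braket (d : nat) (u v : T -> 'cV[Cplx R]_d) :
  (forall i, bmeasurableC (fun x => u x i 0)) ->
  (forall i, bmeasurableC (fun x => v x i 0)) ->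
  bmeasurableC (fun x => braket (u x) (v x)).
Proof.
move=> bu bv; rewrite /braket; under eq_fun do rewrite mxE.
apply: bmeasurableC_sum => i; apply: bmeasurableCM => //.
by under eq_fun do rewrite !mxE; exact: bmeasurableC_conj.
Qed.

Lemma bmeasurable_integrable (mu : probability T R) f :
  bmeasurable f -> mu.-integrable setT (EFin \o f).
Proof.
move=> [mf [B fB]]; apply: measurable_bounded_integrable => //.
  by rewrite (le_lt_trans (probability_le1 _ _)) ?ltry.
by exists B; split=> [|M BM x _]; [exact: num_real|exact: le_trans (fB x) (ltW BM)].
Qed.

End BoundedMeasurable.

Lemma bmeasurable_comp {d1 d2 : measure_display} {T1 : measurableType d1}
  {T2 : measurableType d2} {R : realType} (g : T1 -> T2) (f : T2 -> R) :
  measurable_fun setT g -> bmeasurable f -> bmeasurable (f \o g).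
Proof.
move=> mg [mf [B fB]]; split; first exact: measurableT_comp.
by exists B => x; exact: fB.
Qed.

Lemma bmeasurableC_comp {d1 d2 : measure_display} {T1 : measurableType d1}
  {T2 : measurableType d2} {R : realType} (g : T1 -> T2) (f : T2 -> Cplx R) :
  measurable_fun setT g -> bmeasurableC f -> bmeasurableC (f \o g).
Proof.
move=> mg [rf jf]; split; first exact: (bmeasurable_comp mg rf).
exact: (bmeasurable_comp mg jf).
Qed.

Section Expectation.
Context {disp : measure_display} {T : measurableType disp} {R : realType}.
Variable mu : probability T R.
Implicit Types f g : T -> R.

Lemma expect_cst (a : R) : \int[mu]_x a = a.
Proof.
rewrite /Rintegral integral_cst //= probability_setT mule1 //.
Qed.

Lemma expectD f g : bmeasurable f -> bmeasurable g ->
  \int[mu]_x (f x + g x) = \int[mu]_x f x + \int[mu]_x g x.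
Proof. by move=> bf bg; rewrite RintegralD //; exact: bmeasurable_integrable. Qed.

Lemma expectZ (a : R) f : bmeasurable f -> \int[mu]_x (a * f x) = a * \int[mu]_x f x.
Proof. by move=> bf; rewrite RintegralZl //; exact: bmeasurable_integrable. Qed.

Lemma expect_sum (I : Type) (r : seq I) (f : I -> T -> R) :
  (forall i, bmeasurable (f i)) ->
  \int[mu]_x (\sum_(i <- r) f i x) = \sum_(i <- r) \int[mu]_x f i x.
Proof.
move=> bf; elim: r => [|i r ihr].
  by under eq_Rintegral do rewrite big_nil; rewrite expect_cst big_nil.
under eq_Rintegral do rewrite big_cons.
by rewrite expectD ?big_cons ?ihr //; exact: bmeasurable_sum.
Qed.

Lemma integral_expect f : bmeasurable f -> (\int[mu]_x (f x)%:E)%E = (\int[mu]_x f x)%:E.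
Proof.
move=> bf; rewrite /Rintegral fineK //.
exact: integrable_fin_num (bmeasurable_integrable mu bf).
Qed.

End Expectation.

(** * Topology and Borel structure of SU(d), and invariance of the Haar integral *)

Lemma continuous_eps (C : numFieldType) (R : realType) (f : C -> R) :
  (forall z e, 0 < e -> exists2 r : C, 0 < r &
     forall t, `|z - t| < r -> `|f z - f t| < e) -> continuous f.
Proof.
move=> fP z A /nbhs_ballP[e /= e0 eA]; have [r r0 rP] := fP z e e0.
by apply/nbhs_ballP; exists r => // t /rP ft; exact: eA.
Qed.

(** The topology on matrices is entrywise and there are finitely many entries, so it is enough that
    each entry of the product, a finite linear combination of coordinates of B, is continuous. This
    makes left translations of SU(d) measurable. *)
Lemma continuous_mulmx (C : numFieldType) (m n p : nat) (A : 'M[C]_(m, n)) :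
  continuous (fun B : 'M[C]_(n, p) => A *m B).
Proof.
move=> B X [P nP PX]; rewrite /nbhs /=.
have F : Filter (nbhs B) := nbhs_filter B.
apply: (@filterS _ (nbhs B) _ (fun B' => forall i j, P i j ((A *m B') i j))).
  by move=> B' PB'; apply: PX.
apply: (@filter_forall _ _ (fun i B' => forall j, P i j ((A *m B') i j)) (nbhs B) F) => i.
apply: (@filter_forall _ _ (fun j B' => P i j ((A *m B') i j)) (nbhs B) F) => j.
have: continuous (fun B' : 'M[C]_(n, p) => (A *m B') i j).
  have -> : (fun B' : 'M[C]_(n, p) => (A *m B') i j) =
      (fun B' : 'M[C]_(n, p) => \sum_k A i k * B' k j).
    by apply/funext => B'; rewrite mxE.
  elim: (index_enum _) => [|k r ihr] B'; have F' : Filter (nbhs B') := nbhs_filter B'.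
    have -> : (fun B' : 'M[C]_(n, p) => \sum_(k <- [::]) A i k * B' k j) = (fun=> 0).
      by apply/funext => B''; rewrite big_nil.
    exact: (@cvg_cst C).
  have -> : (fun B' : 'M[C]_(n, p) => \sum_(k <- k :: r) A i k * B' k j) =
      (fun B' => A i k * B' k j + \sum_(k <- r) A i k * B' k j).
    by apply/funext => B''; rewrite big_cons.
  apply: (@cvgD C C^o _ (nbhs B') F' _ _ (A i k * B' k j) _ _ (ihr B')).
  exact: (@cvgMl_tmp C _ (nbhs B') F' _ _ _ (@coord_continuous _ _ _ k j B')).
by move=> /(_ B); apply; exact: nP.
Qed.

Section SpecialUnitaryBorel.
Variables (R : realType) (d : nat).

Lemma continuous_SU_mx : continuous (@SU_mx R d : SU_type R d -> _).
Proof. exact: initial_continuous. Qed.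

Lemma continuous_SU_entry (i j : 'I_d) :
  continuous (fun V : SU_type R d => SU_mx V i j).
Proof.
move=> V; exact: (continuous_comp (@continuous_SU_mx V) (@coord_continuous _ _ _ i j _)).
Qed.

Lemma continuous_normc_bound (f : Cplx R -> R) :
  (forall z t, `|f z - f t| <= Normc.normc (z - t)) -> continuous f.
Proof.
move=> fP; apply: continuous_eps => z e e0; exists e%:C%C => [|t]; rewrite ltcR //.
exact/le_lt_trans.
Qed.

Lemma continuous_Re : continuous (fun z : Cplx R => complex.Re z : R).
Proof.
apply: continuous_normc_bound => -[a b] [a' b'] /=.
by rewrite -sqrtr_sqr ler_wsqrtr // lerDl sqr_ge0.
Qed.

Lemma continuous_Im : continuous (fun z : Cplx R => complex.Im z : R).
Proof.
apply: continuous_normc_bound => -[a b] [a' b'] /=.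
by rewrite -sqrtr_sqr ler_wsqrtr // lerDr sqr_ge0.
Qed.

Lemma measurable_SU_continuous (f : SU R d -> R) :
  continuous (f : SU_type R d -> R) -> measurable_fun setT f.
Proof.
move=> /continuousP cf; apply: (measurability _ (RGenOpens.measurableE R)).
move=> _ [_ [x [y ->]] <-]; rewrite setTI.
apply: sub_sigma_algebra; apply: cf; exact: itv_open.
Qed.

Lemma continuous_SU_mul (U : SU R d) : continuous (SU_mul U : SU_type R d -> SU_type R d).
Proof.
apply: continuous_comp_initial => V.
exact: (continuous_comp (@continuous_SU_mx V) (@continuous_mulmx _ _ _ _ (SU_mx U) _)).
Qed.

Lemma measurable_SU_mul (U : SU R d) : measurable_fun setT (SU_mul U).
Proof.
have H := @measurability _ _ (SU R d) (SU R d) setT (SU_mul U) (@open (SU_type R d)).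
apply: H => // _ [A oA <-].
rewrite setTI.
apply: sub_sigma_algebra; by have /continuousP := @continuous_SU_mul U; exact.
Qed.

(** The rows of a unitary matrix are unit vectors. This is the source of all the boundedness used
    for integrability. *)
Lemma normc_SU_entry (V : SU R d) (i j : 'I_d) : Normc.normc (SU_mx V i j) <= 1.
Proof.
have [/unitarymxP VV _] := set_valP (V : @SUset R d).
have V1 : \sum_k `|SU_mx V i k| ^+ 2 = 1.
  have := congr1 (fun A : 'M[Cplx R]_d => A i i) VV; rewrite !mxE eqxx => H.
  apply: etrans H; apply: eq_bigr => k _.
  by rewrite !mxE normCK /SU_mx set_valE.
have : `|SU_mx V i j| <= 1.
  by rewrite -(@expr_le1 _ 2%N) // -V1 (bigD1 j) //= lerDl sumr_ge0 //.
by rewrite -lecR.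
Qed.

Lemma bmeasurableC_SU_entry (i j : 'I_d) : bmeasurableC (fun V : SU R d => SU_mx V i j).
Proof.
split; (split; [apply: measurable_SU_continuous => V;
  apply: (continuous_comp (@continuous_SU_entry i j V)) | exists 1 => V]).
- exact: continuous_Re.
- apply: le_trans (normc_SU_entry V i j).
  case: (SU_mx V i j) => a b /=; by rewrite -sqrtr_sqr ler_wsqrtr // lerDl sqr_ge0.
- exact: continuous_Im.
- apply: le_trans (normc_SU_entry V i j).
  case: (SU_mx V i j) => a b /=; by rewrite -sqrtr_sqr ler_wsqrtr // lerDr sqr_ge0.
Qed.
End SpecialUnitaryBorel.

Section HaarIntegral.
Variables (R : realType) (d : nat) (mu : probability (SU R d) R).
Hypothesis haar : normalized_haar mu.

(** The left-hand side is the integral of f against the pushforward of mu by the translation, and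
    this pushforward agrees with mu on measurable sets. *)
Lemma haar_expect_mul (U : SU R d) (f : SU R d -> R) :
  bmeasurable f -> (forall V, 0 <= f V) ->
  \int[mu]_V f (SU_mul U V) = \int[mu]_V f V.
Proof.
move=> bf f0; rewrite /Rintegral.
transitivity (fine (\int[pushforward mu (SU_mul U)]_V (f V)%:E)%E).
  rewrite (ge0_integral_pushforward (measurable_SU_mul U)) //.
    by apply/measurable_EFinP; case: bf.
  by move=> V _; rewrite lee_fin.
congr fine; apply: eq_measure_integral => [|mf A mA _]; first exact: measurable_SU_mul.
exact: haar.
Qed.
End HaarIntegral.

(** * Invariance under SU(d) and joint moments *)

Section Braket.
Local Open Scope sesquilinear_scope.
Variables (R : realType) (d : nat).
Implicit Types (u v w : 'cV[Cplx R]_d) (a : Cplx R) (U : 'M[Cplx R]_d).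

Lemma normcE (z : Cplx R) : `|z| = (Normc.normc z)%:C%C. Proof. by []. Qed.

Lemma adjointK m n (A : 'M[Cplx R]_(m, n)) : (A^t*)^t* = A.
Proof. by apply/matrixP => i j; rewrite !mxE conjCK. Qed.

Lemma normc_sqE (z : Cplx R) : (Normc.normc z ^+ 2)%:C%C = z * z^*.
Proof. by rewrite rmorphXn -normCK. Qed.

Lemma normcX2_sum_root (K n : nat) (w p q : Cplx R) :
  K.-primitive_root w -> (n < K)%N ->
  \sum_(k < K) (Normc.normc (p + w ^+ k * q) ^+ 2) ^+ n
  = K%:R * \sum_(j < n.+1) 'C(n, j)%:R ^+ 2
      * (Normc.normc p ^+ 2) ^+ (n - j) * (Normc.normc q ^+ 2) ^+ j.
Proof.
move=> wP nK; apply: complexI.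
rewrite rmorphM rmorph_nat !rmorph_sum /=.
under eq_bigr do rewrite -exprM rmorphXn /= -normcE.
rewrite (sum_normX_root wP) //; congr (_ * _); apply: eq_bigr => j _.
by rewrite !rmorphM /= -!exprM !rmorphXn /= rmorph_nat -!normcE.
Qed.

Lemma braketDr u v w : braket u (v + w) = braket u v + braket u w.
Proof. by rewrite /braket mulmxDr mxE. Qed.

Lemma braketZr u a v : braket u (a *: v) = a * braket u v.
Proof. by rewrite /braket -scalemxAr mxE. Qed.

Lemma braket_conj u v : (braket u v)^* = braket v u.
Proof.
rewrite /braket !mxE rmorph_sum; apply: eq_bigr => i _.
by rewrite !mxE rmorphM /= conjCK mulrC.
Qed.

Lemma braketDl u v w : braket (u + v) w = braket u w + braket v w.
Proof. by rewrite -braket_conj braketDr rmorphD /= !braket_conj. Qed.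

Lemma braketZl u a v : braket (a *: u) v = a^* * braket u v.
Proof. by rewrite -braket_conj braketZr rmorphM /= braket_conj. Qed.

Lemma braketNl u v : braket (- u) v = - braket u v.
Proof. by rewrite -scaleN1r braketZl rmorphN1 mulN1r. Qed.

Lemma braketNr u v : braket u (- v) = - braket u v.
Proof. by rewrite -scaleN1r braketZr mulN1r. Qed.

Lemma braket_unitary U u v : U \is unitarymx -> braket (U *m u) (U *m v) = braket u v.
Proof.
move=> /unitarymxP /mulmx1C UU.
by rewrite /braket trmx_mul map_mxM -mulmxA (mulmxA _ U) UU mul1mx.
Qed.

(** The squared norm as an element of R, whereas [braket u u] is a complex number. *)
Definition nsq u : R := \sum_i Normc.normc (u i 0) ^+ 2.

Lemma nsqE u : braket u u = (nsq u)%:C%C.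
Proof.
rewrite /nsq rmorph_sum /braket mxE; apply: eq_bigr => i _.
by rewrite !mxE rmorphXn /= -normcE normCKC.
Qed.

Lemma nsq_unit u : unit_vector u -> nsq u = 1.
Proof. by rewrite /unit_vector nsqE => /complexI. Qed.

Lemma nsq_eq0 u : nsq u = 0 -> u = 0.
Proof.
move/eqP; rewrite psumr_eq0 => [/allP u0|i _]; last exact: sqr_ge0.
apply/colP => i; have := u0 i (mem_index_enum i); rewrite sqrf_eq0 => /eqP.
by move=> /Normc.eq0_normc ->; rewrite mxE.
Qed.

Lemma overlapC u v : overlap u v = overlap v u.
Proof. by apply: complexI; rewrite /overlap -!normcE -braket_conj norm_conjC. Qed.

Lemma overlapZr u a v : overlap u (a *: v) = Normc.normc a * overlap u v.
Proof. by rewrite /overlap braketZr Normc.normcM. Qed.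

Lemma overlap_sqE u v : (overlap u v ^+ 2)%:C%C = braket u v * braket v u.
Proof. by rewrite rmorphXn /= -normcE normCK braket_conj. Qed.

Lemma overlap_delta u i : overlap u (delta_mx i 0) = Normc.normc (u i 0).
Proof.
apply: complexI; rewrite /overlap -!normcE -norm_conjC braket_conj /braket mxE.
rewrite (bigD1 i) //= big1 ?addr0 => [|k ki]; rewrite !mxE ?eqxx ?conjC1 ?mul1r //.
by rewrite (negPf ki) /= conjC0 mul0r.
Qed.

(** Pythagoras along u: the component of u + z v on u is 1 + z <u|v>, and the orthogonal one has
    squared norm y (1 - |<u|v>|^2). Only the first depends on the phase of z, and it has the shape p
    + w^k q to which averaging over roots of unity applies. *)
Lemma nsq_phase u v (z : Cplx R) (y : R) :
  unit_vector u -> unit_vector v -> Normc.normc z ^+ 2 = y ->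
  nsq (u + z *: v) =
  Normc.normc (1 + z * braket u v) ^+ 2 + y * (1 - overlap u v ^+ 2).
Proof.
move=> u1 v1 <-; apply: complexI.
rewrite -nsqE rmorphD /= [X in _ = _ + X]rmorphM rmorphB /= overlap_sqE !normc_sqE.
rewrite !(braketDl, braketDr, braketZl, braketZr) u1 v1 !rmorphD !rmorphM /=.
by rewrite rmorph1 braket_conj; ring.
Qed.

(* A complex Householder reflection. *)
Lemma unitary_transitive u v : unit_vector u -> unit_vector v ->
  exists2 U, U \is unitarymx & U *m u = v.
Proof.
(* If <v|u> = 1, then |u - v|^2 = 0 and the identity matrix serves. *)
move=> u1 v1; have [s1|s1] := eqVneq (braket v u) 1.
  exists 1%:M; first by apply/unitarymxP; rewrite trmx1 map_mx1 mulmx1.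
  rewrite mul1mx; apply/subr0_eq/nsq_eq0/complexI; rewrite -nsqE.
  rewrite !(braketDl, braketDr, braketNl, braketNr) u1 v1 -(braket_conj v u) s1.
  by rewrite conjC1 rmorph0; ring.
(* The scalar k is chosen so that k <w|u> = 1, whence u - k w <w|u> = u - w = v. Moreover |w|^2 is
   the sum of 1/k and its conjugate, which is the condition for 1 - k |w><w| to be unitary. *)
pose w := u - v; pose k := (1 - braket v u)^-1.
have s0 : 1 - braket v u != 0 by rewrite subr_eq0 eq_sym.
have s0' : 1 - braket u v != 0.
  by rewrite -(braket_conj v u) -[1]conjC1 -rmorphB fmorph_eq0.
have ww : w^t* *m w = (2 - braket v u - braket u v)%:M.
  rewrite [LHS]mx11_scalar -/(braket w w); congr (_%:M).
  by rewrite /w !(braketDl, braketDr, braketNl, braketNr) u1 v1; ring.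
exists (1%:M - k *: (w *m w^t*)).
  apply/unitarymxP.
  have -> : (1%:M - k *: (w *m w^t*))^t* = 1%:M - k^* *: (w *m w^t*).
    rewrite linearB linearZ /= map_mxB map_mxZ trmx1 map_mx1 trmx_mul map_mxM.
    congr (_ - _ *: (_ *m _)); exact: adjointK.
  rewrite mulmxBl mul1mx mulmxBr mulmx1 -scalemxAl -scalemxAr.
  rewrite -mulmxA (mulmxA _ w) ww mul_scalar_mx -scalemxAr !scalerA.
  rewrite -[RHS]addr0 -!addrA; congr (_ + _).
  rewrite -scalerBl -scaleNr -scalerBl [X in X *: _](_ : _ = 0) ?scale0r //.
  rewrite /k fmorphV rmorphB rmorph1 /= braket_conj /=.
  by field; rewrite s0 s0'.
rewrite mulmxBl mul1mx -scalemxAl -mulmxA.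
have -> : w^t* *m u = (1 - braket v u)%:M.
  rewrite [LHS]mx11_scalar -/(braket w u); congr (_%:M).
  by rewrite /w braketDl braketNl u1.
by rewrite mul_mx_scalar scalerA /k mulVf // scale1r /w opprB addrC subrK.
Qed.

(** Scaling the unitary W by a d-th root a of the inverse of its determinant makes the determinant
    1. As det W has modulus 1, so has a, and the image of u changes only by this phase. *)
Lemma SU_transitive u v : (0 < d)%N -> unit_vector u -> unit_vector v ->
  exists U : SU R d, exists2 a, Normc.normc a = 1 & SU_mx U *m u = a *: v.
Proof.
move=> d0 u1 v1; have [W Wu Wuv] := unitary_transitive u1 v1.
have W1 : `|\det W| = 1.
  have /unitarymxP/(congr1 (fun A : 'M[Cplx R]_d => \det A)) := Wu.
  rewrite det_mulmx det1 det_map_mx det_tr -normCK => /eqP.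
  by rewrite (@pexpr_eq1 _ _ 2%N) // => /eqP.
pose a : Cplx R := d.-root (\det W)^-1.
have aX : a ^+ d = (\det W)^-1 by rewrite rootCK.
have a1 : `|a| = 1.
  apply/eqP; rewrite -(pexpr_eq1 d0) // -normrX aX normfV W1 invr1 //.
have aW : SUset (a *: W).
  split; last by rewrite detZ aX mulVf // -normr_eq0 W1 oner_eq0.
  apply/unitarymxP; rewrite linearZ /= map_mxZ -scalemxAl -scalemxAr scalerA.
  by rewrite -normCK a1 expr1n scale1r; apply/unitarymxP.
exists (exist _ (a *: W) (mem_set aW)), a; first by apply: complexI; rewrite -normcE a1.
by rewrite /SU_mx set_valE /= -scalemxAl Wuv.
Qed.

End Braket.

Section Moments.
Variables (R : realType) (d : nat) (mu : probability (SU R d) R).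
Hypotheses (d_gt0 : (0 < d)%N) (haar : normalized_haar mu).
Variable ket0 : 'cV[Cplx R]_d.
Hypothesis ket0_unit : unit_vector ket0.
Implicit Types (u v : 'cV[Cplx R]_d) (V : SU R d).

Local Notation fid V u := (overlap (estimate ket0 V) u ^+ 2).

Lemma bmeasurableC_estimate i : bmeasurableC (fun V => estimate ket0 V i 0).
Proof.
rewrite /estimate; under eq_fun do rewrite mxE.
apply: bmeasurableC_sum => k; apply: bmeasurableCM (bmeasurableC_cst _).
exact: bmeasurableC_SU_entry.
Qed.

Lemma bmeasurable_fid u : bmeasurable (fun V => fid V u).
Proof.
apply: bmeasurable_normc2; apply: bmeasurableC_braket => i.
  exact: bmeasurableC_estimate.
exact: bmeasurableC_cst.
Qed.

Lemma bmeasurable_fidM m n u v : bmeasurable (fun V => fid V u ^+ m * fid V v ^+ n).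
Proof. by apply: bmeasurableM; apply: bmeasurableX; exact: bmeasurable_fid. Qed.

Lemma SU_mx_unitary V : SU_mx V \is unitarymx.
Proof. by have [] := set_valP (V : @SUset R d). Qed.

Lemma estimate_unit V : unit_vector (estimate ket0 V).
Proof. by rewrite /unit_vector braket_unitary ?SU_mx_unitary. Qed.

Definition moment n u : R := \int[mu]_V (fid V u ^+ n).

(** Translate the integral for v by some U in SU(d) with U u = a v, |a| = 1. Unitarity moves U to
    the other side of the overlap, and the modulus absorbs a. *)
Lemma moment_unit n u v : unit_vector u -> unit_vector v -> moment n u = moment n v.
Proof.
move=> u1 v1; have [U [a a1 Uu]] := SU_transitive d_gt0 u1 v1.
rewrite /moment -[RHS](haar_expect_mul haar U); last 2 first.
- exact: bmeasurableX (bmeasurable_fid v).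
- by move=> V; rewrite exprn_ge0 // sqr_ge0.
congr Rintegral; apply/funext => V; congr (_ ^+ 2 ^+ _).
rewrite -[RHS]mul1r -a1 -overlapZr -Uu /estimate /overlap.
rewrite [SU_mx (SU_mul U V)]/SU_mx set_valE /= -mulmxA.
by rewrite braket_unitary ?SU_mx_unitary.
Qed.

(** The integrand is homogeneous of degree 2n in u, so normalizing u reduces the claim to
    [moment_unit]. *)
Lemma momentE n u : moment n u = moment n ket0 * nsq u ^+ n.
Proof.
(* For n = 0 both sides are the same integral of 1, even at u = 0, by the convention 0^0 = 1; for
   positive n and u = 0 both sides vanish. *)
case: n => [|n]; first by rewrite /moment !expr0 mulr1; congr Rintegral.
have [u0|u0] := eqVneq (nsq u) 0.
  rewrite u0 expr0n mulr0 /moment (nsq_eq0 u0) -[RHS](expect_cst mu 0).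
  congr Rintegral; apply/funext => V.
  by rewrite -[0](scale0r 0) overlapZr Normc.normc0 mul0r !expr0n.
have nu : 0 < nsq u by rewrite lt_def u0 sumr_ge0 // => i _; exact: sqr_ge0.
pose r : Cplx R := ((Num.sqrt (nsq u))%:C)%C.
have r2 : r * r = ((nsq u)%:C)%C by rewrite -rmorphM -expr2 sqr_sqrtr // ltW.
have rR : r \is Num.real by apply: ger0_real; rewrite lecR sqrtr_ge0.
have r0 : r != 0 by apply: contraNneq u0 => r0; apply/eqP/complexI; rewrite -r2 r0 mul0r.
pose v := r^-1 *: u; have uv : u = r *: v by rewrite scalerA divff // scale1r.
have v1 : unit_vector v.
  rewrite /unit_vector braketZl braketZr nsqE -r2.
  by rewrite (conj_Creal (rpredVr rR)); field.
rewrite (moment_unit _ ket0_unit v1) /moment uv mulrC -expectZ; last first.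
  exact: bmeasurableX (bmeasurable_fid v).
congr Rintegral; apply/funext => V; rewrite -exprMn; congr (_ ^+ _).
rewrite overlapZr exprMn; congr (_ * _).
apply: complexI; rewrite -nsqE -uv normc_sqE nsqE -r2; congr (_ * _).
exact: conj_Creal.
Qed.

(** The sum of the moments of u + w^k r v over the powers of a root of unity w is evaluated twice:
    inside the integral, where it produces the joint moments, and through [momentE], where it
    involves only norms. [moment_coef] then isolates the power j of r^2. *)
Lemma fid_moment M j u v : unit_vector u -> unit_vector v ->
  let x := overlap u v ^+ 2 in
  'C(M + j, j)%:R ^+ 2 * \int[mu]_V (fid V u ^+ M * fid V v ^+ j) =
  moment (M + j) ket0 * \sum_(l < j.+1)
    'C(M + j, M + l)%:R * 'C(M + l, l)%:R ^+ 2 * (1 - x) ^+ (j - l) * x ^+ l.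
Proof.
move=> u1 v1 x.
pose e i := \int[mu]_V (fid V u ^+ (M + j - i) * fid V v ^+ i).
have -> : \int[mu]_V (fid V u ^+ M * fid V v ^+ j) = e j by rewrite /e addnK.
apply: moment_coef => y; set n := (M + j)%N.
have [w wP] := primitive_root_exists (Cplx R) (ltn0Sn n).
(* Natural values of y = r^2 are all that [moment_coef] asks for. *)
pose r : Cplx R := ((Num.sqrt y%:R)%:C)%C.
have r2 : Normc.normc r ^+ 2 = y%:R.
  by rewrite /r /= expr0n /= addr0 sqrtr_sqr ger0_norm ?sqrtr_ge0 // sqr_sqrtr.
have wr2 (k : nat) : Normc.normc (w ^+ k * r) ^+ 2 = y%:R.
  have w1 : `|w| = 1.
    by apply/eqP; rewrite -(pexpr_eq1 (ltn0Sn n)) // -normrX (prim_expr_order wP) normr1.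
  rewrite Normc.normcM -[Normc.normc (w ^+ k)](_ : 1 = _) ?mul1r //.
  by apply: complexI; rewrite -normcE normrX w1 expr1n.
have n1 : (n.+1)%:R != 0 :> R by rewrite pnatr_eq0.
apply: (mulfI n1).
transitivity (\sum_(k < n.+1) moment n (u + (w ^+ k * r) *: v)).
  rewrite /moment -expect_sum => [|k]; last exact: bmeasurableX (bmeasurable_fid _).
  have E V : \sum_(k < n.+1) fid V (u + (w ^+ k * r) *: v) ^+ n =
     n.+1%:R * \sum_(i < n.+1) 'C(n, i)%:R ^+ 2 * y%:R ^+ i *
       (fid V u ^+ (n - i) * fid V v ^+ i).
    under eq_bigr do rewrite /overlap braketDr braketZr -mulrA.
    rewrite (normcX2_sum_root _ _ wP) //; congr (_ * _); apply: eq_bigr => i _.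
    rewrite Normc.normcM [(_ * _) ^+ 2]exprMn r2 [(y%:R * _) ^+ i]exprMn /overlap.
    move: (_ ^+ i) (_ ^+ i) (_ ^+ (n - i)) => *; ring.
  have -> : (fun V => \sum_(k < n.+1) fid V (u + (w ^+ k * r) *: v) ^+ n) = _ := funext E.
  have bm i : bmeasurable (fun V => 'C(n, i)%:R ^+ 2 * y%:R ^+ i *
       (fid V u ^+ (n - i) * fid V v ^+ i)).
    by apply: bmeasurableM (bmeasurable_cst _) _; exact: bmeasurable_fidM.
  rewrite expectZ ?expect_sum //; last exact: bmeasurable_sum.
  congr (_ * _); apply: eq_bigr => i _.
  by rewrite expectZ -?/(e i) 1?mulrAC //; exact: bmeasurable_fidM.
(* Second evaluation: the n-th power of the norm is expanded binomially in its phase-free part y (1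
   - x), and each power of the remaining part is averaged over the roots of unity. *)
under eq_bigr do rewrite momentE (nsq_phase u1 v1 (wr2 _)) -/x.
rewrite -mulr_sumr mulrCA; congr (_ * _).
symmetry; under [RHS]eq_bigr do rewrite addrC exprDn.
rewrite exchange_big mulr_sumr; apply: eq_bigr => i _ /=.
under [RHS]eq_bigr do rewrite -mulr_natl mulrA.
rewrite -mulr_sumr mulrCA; congr (_ * _).
under [RHS]eq_bigr do rewrite -[_ * r * _]mulrA.
rewrite (normcX2_sum_root _ _ wP) //; congr (_ * _); apply: eq_bigr => l _.
by rewrite Normc.normc1 !expr1n mulr1 Normc.normcM [(_ * _) ^+ 2]exprMn r2.
Qed.

End Moments.

(** * Moments of the covariant density *)

Section DensityMoments.
Variables (R : realType) (d : nat) (mu : probability (SU R d) R).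
Hypotheses (d_gt0 : (0 < d)%N) (haar : normalized_haar mu).
Variable ket0 : 'cV[Cplx R]_d.
Hypothesis ket0_unit : unit_vector ket0.
Implicit Types (u v : 'cV[Cplx R]_d) (V : SU R d).

Local Notation fid V u := (overlap (estimate ket0 V) u ^+ 2).
Local Notation dens := (covariant_density ket0).

Lemma delta_unit (i : 'I_d) : unit_vector (delta_mx i 0 : 'cV[Cplx R]_d).
Proof.
rewrite /unit_vector /braket mxE (bigD1 i) //= big1 ?addr0 => [|k ki].
  by rewrite !mxE !eqxx conjC1 mul1r.
by rewrite !mxE (negPf ki) mulr0.
Qed.

Lemma fid_moment1 n u v : unit_vector u -> unit_vector v ->
  n.+1%:R * \int[mu]_V (fid V u ^+ n * fid V v) =
  moment mu ket0 n.+1 ket0 * (1 + n%:R * overlap u v ^+ 2).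
Proof.
move=> u1 v1; have := fid_moment d_gt0 haar ket0_unit n 1 u1 v1.
rewrite /= !big_ord_recr big_ord0 /= !addn0 addn1 bin1 bin0 binn binSn.
rewrite !expr0 !expr1 -natr1 => H.
have n0 : n%:R + 1 != 0 :> R by rewrite natr1 pnatr_eq0.
apply: (mulfI n0); rewrite mulrA -expr2 H; ring.
Qed.

(** Sum [fid_moment1] with u = [ket0] and v running over the standard basis. By Parseval the squared
    overlaps sum to 1, both for the estimate under the integral and for [ket0] on the right. *)
Lemma moment_rec n :
  moment mu ket0 n ket0 * n.+1%:R = moment mu ket0 n.+1 ket0 * (d%:R + n%:R).
Proof.
have Vsum V : \sum_i fid V (delta_mx i 0) = 1.
  under eq_bigr do rewrite overlap_delta.
  exact: nsq_unit (estimate_unit ket0_unit V).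
have usum : \sum_i overlap ket0 (delta_mx i 0) ^+ 2 = 1.
  by under eq_bigr do rewrite overlap_delta; exact: nsq_unit.
have -> : moment mu ket0 n ket0 =
    \sum_i \int[mu]_V (fid V ket0 ^+ n * fid V (delta_mx i 0)).
  rewrite -expect_sum => [|i]; last exact: (bmeasurable_fidM _ n 1).
  by congr Rintegral; apply/funext => V; rewrite -mulr_sumr Vsum mulr1.
rewrite mulrC mulr_sumr.
under eq_bigr do rewrite (fid_moment1 _ ket0_unit (delta_unit _)).
by rewrite -mulr_sumr big_split /= -mulr_sumr usum mulr1 sumr_const card_ord.
Qed.

(** The inverse binomials satisfy the recursion [moment_rec] and start at 1. Hence the prefactor in
    [covariant_density], the dimension of the symmetric subspace, normalizes it. *)
Lemma moment_bin n : 'C(n + d - 1, d - 1)%:R * moment mu ket0 n ket0 = 1.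
Proof.
have binE (k : nat) : ('C(k.+1 + d - 1, d - 1) * k.+1 = 'C(k + d - 1, d - 1) * (d + k))%N.
  have [d' ->] : exists d', d = d'.+1 by exists d.-1; rewrite prednK.
  have := mul_bin_down (k.+1 + d') d'; rewrite addnK => H.
  rewrite !addnS !subn1 /=.
  by rewrite mulnC -H mulnC; congr (_ * _)%N; lia.
elim: n => [|n ihn].
  by rewrite add0n binn mul1r /moment -[RHS](expect_cst mu 1); congr Rintegral.
have dn : d%:R + n%:R != 0 :> R by rewrite -natrD pnatr_eq0 -lt0n addn_gt0 d_gt0.
have n1 : n.+1%:R != 0 :> R by rewrite pnatr_eq0.
apply: (mulIf n1); apply: (mulIf dn); rewrite mul1r.
transitivity ('C(n.+1 + d - 1, d - 1)%:R * n.+1%:R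
    * (moment mu ket0 n.+1 ket0 * (d%:R + n%:R))); first by ring.
rewrite -moment_rec -natrM binE natrM natrD.
transitivity ('C(n + d - 1, d - 1)%:R * moment mu ket0 n ket0 * (n.+1%:R * (d%:R + n%:R))).
  by ring.
by rewrite ihn mul1r.
Qed.

Lemma densE n u V : dens n u V = 'C(n + d - 1, d - 1)%:R * fid V u ^+ n.
Proof. by rewrite /covariant_density exprM. Qed.

Lemma bmeasurable_dens n u : bmeasurable (dens n u).
Proof.
rewrite (funext (densE n u)); apply: bmeasurableM (bmeasurable_cst _) _.
exact: bmeasurableX (bmeasurable_fid _ _).
Qed.

Lemma dens_moment0 n u : unit_vector u -> \int[mu]_V dens n u V = 1.
Proof.
move=> u1; rewrite (funext (densE n u)).
rewrite expectZ; last exact: bmeasurableX (bmeasurable_fid _ _).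
by rewrite -/(moment mu ket0 n u) (moment_unit d_gt0 haar _ n u1 ket0_unit) moment_bin.
Qed.

Lemma dens_moment1 n u v : unit_vector u -> unit_vector v ->
  \int[mu]_V (dens n u V * fid V v) =
  (1 + n%:R * overlap u v ^+ 2) / (n%:R + d%:R).
Proof.
move=> u1 v1.
have -> : (fun V => dens n u V * fid V v) =
    (fun V => 'C(n + d - 1, d - 1)%:R * (fid V u ^+ n * fid V v)).
  by apply/funext => V; rewrite densE mulrA.
rewrite expectZ; last exact: (bmeasurable_fidM _ n 1).
have m1 := moment_bin n; have mr := moment_rec n; have f1 := fid_moment1 n u1 v1.
have n0 : n.+1%:R != 0 :> R by rewrite pnatr_eq0.
have nd : n%:R + d%:R != 0 :> R by rewrite -natrD pnatr_eq0 -lt0n addn_gt0 d_gt0 orbT.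
apply: (mulfI n0); rewrite mulrCA f1.
apply: (mulIf nd); rewrite -[RHS]mulrA divfK //.
transitivity ('C(n + d - 1, d - 1)%:R * (moment mu ket0 n.+1 ket0 * (d%:R + n%:R))
   * (1 + n%:R * overlap u v ^+ 2)); first by ring.
by rewrite -mr mulrA m1 mul1r.
Qed.

Lemma dens_moment2 n u v : unit_vector u -> unit_vector v ->
  \int[mu]_V (dens n u V * fid V v ^+ 2) =
  (2 + 4 * n%:R * overlap u v ^+ 2 + n%:R * (n%:R - 1) * (overlap u v ^+ 2) ^+ 2)
   / ((n%:R + d%:R) * (n%:R + d%:R + 1)).
Proof.
move=> u1 v1.
have -> : (fun V => dens n u V * fid V v ^+ 2) =
    (fun V => 'C(n + d - 1, d - 1)%:R * (fid V u ^+ n * fid V v ^+ 2)).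
  by apply/funext => V; rewrite densE mulrA.
rewrite expectZ; last exact: bmeasurable_fidM.
have m1 := moment_bin n; have mr := moment_rec n; have mr' := moment_rec n.+1.
have := fid_moment d_gt0 haar ket0_unit n 2 u1 v1.
rewrite /= !big_ord_recr big_ord0 /= addn0 addn1 addn2 bin0 bin1 binn binSn.
have -> : 'C(n.+2, n) = 'C(n.+2, 2) by rewrite -(@bin_sub _ 2) ?subn2.
have B2 : 2 * 'C(n.+2, 2)%:R = (n%:R + 1) * (n%:R + 2) :> R.
  by rewrite -natrM -(mul_bin_diag n.+2 1) bin1 natrM /= -!natr1; ring.
have nd : n%:R + d%:R != 0 :> R by rewrite -natrD pnatr_eq0 -lt0n addn_gt0 d_gt0 orbT.
have nd1 : n%:R + d%:R + 1 != 0 :> R by rewrite -natrD natr1 pnatr_eq0.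
have n1 : n%:R + 1 != 0 :> R by rewrite natr1 pnatr_eq0.
have n2 : n%:R + 2 != 0 :> R by rewrite -natrD pnatr_eq0 addn2.
have B0 : 'C(n.+2, 2)%:R != 0 :> R by rewrite pnatr_eq0 -lt0n bin_gt0.
have BE : 'C(n.+2, 2)%:R = (n%:R + 1) * (n%:R + 2) / 2 :> R.
  by rewrite -B2; field.
rewrite -!natr1 in mr mr' * => f2.
(* Two steps of the recursion express the moment of order n + 2 through the one of order n, which
   cancels against the normalization of the density. *)
have m2E : moment mu ket0 n.+2 ket0 = moment mu ket0 n ket0 * (n%:R + 1) * (n%:R + 2)
    / ((n%:R + d%:R) * (n%:R + d%:R + 1)).
  apply: (mulIf nd1); apply: (mulIf nd); rewrite [LHS](_ : _ = 
   moment mu ket0 n.+2 ket0 * (d%:R + (n%:R + 1)) * (d%:R + n%:R)); last by ring.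
  rewrite -mr' [LHS](_ : _ = moment mu ket0 n.+1 ket0 * (d%:R + n%:R) * (n%:R + 2)); last by ring.
  by rewrite -mr; field; rewrite nd nd1.
apply: (mulfI (expf_neq0 2 B0)).
rewrite mulrCA f2 m2E.
set m := moment _ _ _ _ in m1 *; rewrite [LHS](_ : _ = ('C(n + d - 1, d - 1)%:R * m) *
  ((n%:R + 1) * (n%:R + 2)
    / ((n%:R + d%:R) * (n%:R + d%:R + 1)) * ('C(n.+2, 2)%:R * (1 - overlap u v ^+ 2) ^+ 2
    + (n%:R + 2) * (n%:R + 1) ^+ 2 * (1 - overlap u v ^+ 2) * overlap u v ^+ 2
    + 'C(n.+2, 2)%:R ^+ 2 * (overlap u v ^+ 2) ^+ 2))); last first.
  by ring.
rewrite m1 mul1r BE; field; rewrite nd nd1 //.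
Qed.

(** This form serves for both integrations: averaging a quadratic polynomial in the fidelity with v
    gives again a quadratic polynomial in |<u|v>|^2. *)
Lemma dens_quadratic n u v (a b e : R) : unit_vector u -> unit_vector v ->
  \int[mu]_V (dens n u V * (a * fid V v ^+ 2 + b * fid V v + e)) =
  a * ((2 + 4 * n%:R * overlap u v ^+ 2
        + n%:R * (n%:R - 1) * (overlap u v ^+ 2) ^+ 2)
       / ((n%:R + d%:R) * (n%:R + d%:R + 1)))
  + b * ((1 + n%:R * overlap u v ^+ 2) / (n%:R + d%:R)) + e.
Proof.
move=> u1 v1; have bd := bmeasurable_dens n u.
have b1 := bmeasurableM bd (bmeasurable_fid ket0 v).
have b2 := bmeasurableM bd (bmeasurableX 2 (bmeasurable_fid ket0 v)).
have -> : (fun V => dens n u V * (a * fid V v ^+ 2 + b * fid V v + e)) =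
    (fun V => a * (dens n u V * fid V v ^+ 2) + b * (dens n u V * fid V v) + e * dens n u V).
  by apply/funext => V; ring.
have c1 := bmeasurableM (bmeasurable_cst b) b1.
have c2 := bmeasurableM (bmeasurable_cst a) b2.
have c0 := bmeasurableM (bmeasurable_cst e) bd.
rewrite (expectD _ (bmeasurableD c2 c1) c0) (expectD _ c2 c1).
rewrite (expectZ mu a b2) (expectZ mu b b1) (expectZ mu e bd).
by rewrite dens_moment0 // dens_moment1 // dens_moment2 // mulr1.
Qed.

End DensityMoments.

(** * The mean square error *)

Section MeanSquareError.
Variables (R : realType) (d : nat) (mu : probability (SU R d) R).
Hypotheses (d_gt0 : (0 < d)%N) (haar : normalized_haar mu).
Variables ket0 phi psi : 'cV[Cplx R]_d.
Hypotheses (ket0_unit : unit_vector ket0).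
Hypotheses (phi_unit : unit_vector phi) (psi_unit : unit_vector psi).

Let c := overlap psi phi ^+ 2.

Lemma bmeasurable_ee_estimator : bmeasurable (ee_estimator (d := d) ket0).
Proof.
apply: bmeasurable_normc2; apply: bmeasurableC_braket => i.
  exact: (bmeasurableC_comp (@measurable_fst _ _ _ _) (bmeasurableC_estimate ket0 i)).
exact: (bmeasurableC_comp (@measurable_snd _ _ _ _) (bmeasurableC_estimate ket0 i)).
Qed.

Lemma bmeasurable_joint_density M N : bmeasurable (joint_density ket0 phi psi M N).
Proof.
apply: bmeasurableM.
  exact: (bmeasurable_comp (@measurable_fst _ _ _ _) (bmeasurable_dens ket0 M phi)).
exact: (bmeasurable_comp (@measurable_snd _ _ _ _) (bmeasurable_dens ket0 N psi)).
Qed.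

Lemma dens_ge0 n u V : 0 <= covariant_density (R := R) (d := d) ket0 n u V.
Proof. rewrite densE; apply: mulr_ge0; first exact: ler0n.
apply: exprn_ge0. exact: sqr_ge0. Qed.

(** The integrand is nonnegative, so Tonelli applies, and the density of V is constant in the inner
    integral over W. *)
Lemma ee_mse_iterated M N : ee_mse mu ket0 phi psi M N =
  (\int[mu]_V (covariant_density ket0 M phi V *
     \int[mu]_W (covariant_density ket0 N psi W *
       (overlap (estimate ket0 W) (estimate ket0 V) ^+ 2 - c) ^+ 2))%:E)%E.
Proof.
rewrite /ee_mse /ee_expectation fubini_tonelli1; last 2 first.
- apply/measurable_EFinP.
  have bX := bmeasurableX 2 (bmeasurableD bmeasurable_ee_estimator (bmeasurable_cst (- c))).
  by have [] := bmeasurableM bX (bmeasurable_joint_density M N).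
- move=> p; rewrite lee_fin mulr_ge0 ?sqr_ge0 //.
  by apply: mulr_ge0; exact: dens_ge0.
have bX V : bmeasurable (fun W => (overlap (estimate ket0 W) (estimate ket0 V) ^+ 2 - c) ^+ 2).
  apply: bmeasurableX; apply: bmeasurableD (bmeasurable_cst _).
  exact: bmeasurable_fid.
have bI V := bmeasurableM (bmeasurable_dens ket0 N psi) (bX V).
apply: eq_integral => V _; rewrite /fubini_F.
rewrite EFinM -integral_expect // -ge0_integralZl_EFin //; last 3 first.
- by move=> W _; rewrite lee_fin mulr_ge0 ?dens_ge0 ?sqr_ge0.
- by apply/measurable_EFinP; case: (bI V).
- exact: dens_ge0.
apply: eq_integral => W _; rewrite -EFinM; congr EFin.
by rewrite /joint_density /ee_estimator /= (overlapC (estimate ket0 V)) -/c; ring.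
Qed.

Lemma ee_mse_formula M N :
  ee_mse mu ket0 phi psi M N =
  ((d%:R + M%:R + N%:R)
     * ((2 + c * (c * d%:R - 2) * (d%:R + 1)) * (d%:R + M%:R + N%:R + 1)
        + 2 * c * (1 - c) * M%:R * N%:R)
   / ((d%:R + M%:R) * (d%:R + M%:R + 1)
      * (d%:R + N%:R) * (d%:R + N%:R + 1)))%:E.
Proof.
rewrite ee_mse_iterated.
have nz k : k%:R + d%:R != 0 :> R by rewrite -natrD pnatr_eq0 -lt0n addn_gt0 d_gt0 orbT.
have nz1 k : k%:R + d%:R + 1 != 0 :> R by rewrite -natrD natr1 pnatr_eq0.
(* With V fixed, the mean of w^2 - 2cw + c^2 over W is quadratic in the squared overlap of the
   estimate of V with psi; a, b and e are its coefficients. *)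
pose a : R := (N%:R * (N%:R - 1)) / ((N%:R + d%:R) * (N%:R + d%:R + 1)).
pose b : R := (4 * N%:R) / ((N%:R + d%:R) * (N%:R + d%:R + 1))
   - 2 * c * N%:R / (N%:R + d%:R).
pose e : R := 2 / ((N%:R + d%:R) * (N%:R + d%:R + 1)) - 2 * c / (N%:R + d%:R) + c ^+ 2.
have inner V : \int[mu]_W (covariant_density ket0 N psi W *
       (overlap (estimate ket0 W) (estimate ket0 V) ^+ 2 - c) ^+ 2) =
   a * (overlap (estimate ket0 V) psi ^+ 2) ^+ 2
   + b * overlap (estimate ket0 V) psi ^+ 2 + e.
  transitivity (\int[mu]_W (covariant_density ket0 N psi W *
       (1 * (overlap (estimate ket0 W) (estimate ket0 V) ^+ 2) ^+ 2
        + (- 2 * c) * overlap (estimate ket0 W) (estimate ket0 V) ^+ 2 + c ^+ 2))).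
    by congr Rintegral; apply/funext => W; ring.
  rewrite (dens_quadratic d_gt0 haar) //; last exact: estimate_unit.
  by rewrite (overlapC psi) /a /b /e; field; rewrite nz nz1.
under eq_integral do rewrite inner.
rewrite integral_expect; last first.
  apply: bmeasurableM (bmeasurable_dens _ _ _) _.
  apply: bmeasurableD (bmeasurable_cst _); apply: bmeasurableD.
    apply: bmeasurableM (bmeasurable_cst _) _.
    exact: bmeasurableX (bmeasurable_fid _ _).
  exact: bmeasurableM (bmeasurable_cst _) (bmeasurable_fid _ _).
congr EFin; rewrite (dens_quadratic d_gt0 haar) // (overlapC phi) -/c /a /b /e.
rewrite (addrC d%:R M%:R) (addrC d%:R N%:R); field.
by rewrite !nz !nz1.
Qed.

End MeanSquareError.

(** * Asymptotics *)

Section Asymptotics.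
Variables (R : realType) (d P Q : R).
Hypothesis d_gt0 : 0 < d.

(** P stands for 2 + c(cd - 2)(d + 1) and Q for 2c(1 - c); the asymptotics treat them as free
    parameters. *)
Definition mse_rat (M N : R) : R :=
  (d + M + N) * (P * (d + M + N + 1) + Q * M * N)
  / ((d + M) * (d + M + 1) * (d + N) * (d + N + 1)).

Definition mse_lim (N : R) : R := (P + Q * N) / ((d + N) * (d + N + 1)).

Lemma denom_neq0 (n : nat) : (d + n%:R != 0) * (d + n%:R + 1 != 0).
Proof. by rewrite !gt_eqF // ?ltr_wpDr // ltr_wpDr. Qed.

Lemma cvg_affine (s : nat -> R) (a b : R) : s @ \oo --> 0 ->
  (fun n => a + b * s n) @ \oo --> a.
Proof.
move=> s0; rewrite -[X in _ --> X]addr0; apply: cvgD; first exact: cvg_cst.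
by rewrite -(mulr0 b); apply: cvgM => //; exact: cvg_cst.
Qed.

Lemma natV_cvg0 : (fun n : nat => n%:R^-1 : R) @ \oo --> 0.
Proof.
apply/gtr0_cvgV0; last exact: cvgr_idn.
by near=> n; rewrite ltr0n; near: n; exact: nbhs_infty_gt.
Unshelve. all: by end_near. Qed.

Lemma mse_rat_cvg (N : nat) : (fun M : nat => mse_rat M%:R N%:R) @ \oo --> mse_lim N%:R.
Proof.
(* Numerator and denominator of [mse_rat] divided by M^2, with s = 1/M; the limit is the value at s
   = 0. *)
pose f (s : R) := (1 + (d + N%:R) * s) * (P + Q * N%:R + P * (d + N%:R + 1) * s)
   / ((1 + d * s) * (1 + (d + 1) * s) * ((d + N%:R) * (d + N%:R + 1))).
have [dN dN1] := denom_neq0 N.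
have H : (fun M : nat => f (M%:R^-1)) @ \oo --> mse_lim N%:R.
  rewrite (_ : mse_lim _ =
    1 * (P + Q * N%:R) / (1 * 1 * ((d + N%:R) * (d + N%:R + 1)))); last first.
    by rewrite !mul1r.
  apply: cvgM; first by apply: cvgM; apply: cvg_affine natV_cvg0.
  apply: cvgV; first by rewrite !mul1r mulf_neq0.
  apply: cvgM; last exact: cvg_cst.
  by apply: cvgM; apply: cvg_affine natV_cvg0.
apply: cvg_trans H; apply: near_eq_cvg; near=> M.
have M0 : 0 < M%:R :> R by rewrite ltr0n; near: M; exact: nbhs_infty_gt.
rewrite /f /mse_rat; field.
by rewrite dN dN1 !denom_neq0 gt_eqF.
Unshelve. all: by end_near. Qed.

Lemma mse_lim_bigO :
  (fun N : nat => mse_lim N%:R) = (fun N : nat => Q / N%:R)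
            +O_\oo (fun N : nat => N%:R ^- 2 : R).
Proof.
(* Clearing denominators in [mse_lim] N - Q/N leaves the numerator A N - B. For N at least 1 it is
   bounded by (|A| + |B|) N, while the denominator is at least N^3. *)
pose A := P - Q * (2 * d + 1); pose B := Q * d * (d + 1).
apply/eqaddOP; near=> k; near=> N => /=.
have kAB : `|A| + `|B| <= k by near: k; exact: nbhs_pinfty_ge.
have N1 : 1 <= N%:R :> R by rewrite ler1n; near: N; exact: nbhs_infty_gt.
have [dN dN1] := denom_neq0 N.
have N0 : 0 < N%:R :> R by exact: lt_le_trans N1.
have Nn0 : N%:R != 0 :> R by rewrite gt_eqF.
have D0 : 0 < N%:R * ((d + N%:R) * (d + N%:R + 1)) :> R.
  by rewrite !mulr_gt0 // ?ltr_wpDr // ltr_wpDr.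
have E : mse_lim N%:R - Q / N%:R =
    (A * N%:R - B) / (N%:R * ((d + N%:R) * (d + N%:R + 1))).
  by rewrite /mse_lim /A /B; field; rewrite dN dN1 Nn0.
apply: (@le_trans _ _ `|(A * N%:R - B) / (N%:R * ((d + N%:R) * (d + N%:R + 1)))|).
  by rewrite -E.
rewrite normrM normfV (gtr0_norm D0) ler_pdivrMr // normfV normrX (gtr0_norm N0).
have k0 : 0 <= k by rewrite (le_trans _ kAB) // addr_ge0.
apply: (@le_trans _ _ (k * N%:R)).
  rewrite (le_trans (ler_normB _ _)) // normrM (gtr0_norm N0).
  rewrite (le_trans _ (ler_wpM2r (ltW N0) kAB)) // mulrDl lerD2l.
  by rewrite ler_peMr.
rewrite -mulrA ler_wpM2l // [leRHS](_ : _ = (d + N%:R) * (d + N%:R + 1) / N%:R); last by field.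
rewrite ler_pdivlMr //.
have dNN : N%:R <= d + N%:R by rewrite lerDr ltW.
by apply: ler_pM => //; exact: ler_wpDr.
Unshelve. all: by end_near. Qed.

Lemma mse_rat_equiv (k : R) (Ms Ns : nat -> nat) : Q != 0 ->
  (forall n, (Ms n)%:R - (Ns n)%:R = k) ->
  (Ms n + Ns n)%N @[n --> \oo] --> \oo ->
  (fun n => mse_rat (Ms n)%:R (Ns n)%:R) ~_\oo
  (fun n => 4 * Q / ((Ms n)%:R + (Ns n)%:R)).
Proof.
move=> Q0 hk hS.
pose s n : R := (Ms n + Ns n)%:R^-1.
have s0 : s @ \oo --> 0 := cvg_comp _ _ hS natV_cvg0.
(* With S = M + N and s = 1/S one has M = (S + k)/2, N = (S - k)/2 and MN = (S^2 - k^2)/4. Then h s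
   is the quotient of [mse_rat] by 4Q/S, scaled by S^4, and its value at 0 is 1. *)
pose h (s : R) := (1 + d * s) * ((Q / 4 + P * s) + (P * (d + 1) - Q / 4 * k ^+ 2) * s ^+ 2)
  / ((2^-1 + (d + k / 2) * s) * (2^-1 + (d + 1 + k / 2) * s)
     * (2^-1 + (d - k / 2) * s) * (2^-1 + (d + 1 - k / 2) * s) * (4 * Q)).
have H : h \o s @ \oo --> (1 : R).
  rewrite (_ : 1 = 1 * (Q / 4 + 0) / (2^-1 * 2^-1 * 2^-1 * 2^-1 * (4 * Q))); last by field.
  apply: cvgM.
    apply: cvgM; first exact: cvg_affine.
    apply: cvgD; first exact: cvg_affine.
    rewrite -(mulr0 (P * (d + 1) - Q / 4 * k ^+ 2)); apply: cvgM; first exact: cvg_cst.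
    by rewrite -(mulr0 0); apply: cvgM.
  apply: cvgV.
    by rewrite !mulf_neq0 // ?invr_eq0 pnatr_eq0.
  by do ?apply: cvgM; do ?[exact: cvg_affine | exact: cvg_cst].
apply/eqaddoP => e e0.
have He : \forall n \near \oo, `|1 - h (s n)| < e.
  by move/cvgrPdist_lt : H; exact.
near=> n => /=.
have S0 : (0 < Ms n + Ns n)%N.
  by near: n; exact: (hS _ (nbhs_infty_gt 0)).
have he : `|1 - h (s n)| < e by near: n.
have S0' : (Ms n)%:R + (Ns n)%:R != 0 :> R by rewrite -natrD pnatr_eq0 -lt0n.
have E : mse_rat (Ms n)%:R (Ns n)%:R - 4 * Q / ((Ms n)%:R + (Ns n)%:R) =
   - (1 - h (s n)) * (4 * Q / ((Ms n)%:R + (Ns n)%:R)).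
  rewrite /mse_rat /h /s -(hk n) natrD.
  (* Once k is replaced by M - N, the factors of the denominator of h are, up to powers of 2 and of
     S, those of [mse_rat]; hence they are nonzero. *)
  have W (x y : R) : x + y + ((d + 1) * 2 - (x - y)) = 2 * (d + y + 1) by ring.
  have W' (x y : R) : x + y + (d * 2 - (x - y)) = 2 * (d + y) by ring.
  have Z (x y : R) : x + y + ((d + 1) * 2 + (x - y)) = 2 * (d + x + 1) by ring.
  have Z' (x y : R) : x + y + (d * 2 + (x - y)) = 2 * (d + x) by ring.
  by field; rewrite W W' Z Z' !mulf_neq0 ?denom_neq0 ?S0' ?Q0 ?pnatr_eq0.
apply: (@le_trans _ _ `|- (1 - h (s n)) * (4 * Q / ((Ms n)%:R + (Ns n)%:R))|).
  by rewrite -E.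
by rewrite normrM normrN ler_wpM2r // ltW.
Unshelve. all: by end_near. Qed.
End Asymptotics.

Theorem mainTheorem9 (R : realType) (d : nat) (hd : (2 <= d)%N)
  (mu : probability (SU R d) R) (hmu : normalized_haar mu)
  (ket0 phi psi : 'cV[Cplx R]_d)
  (hket0 : unit_vector ket0) (hphi : unit_vector phi) (hpsi : unit_vector psi)
  (c : R) (hc : overlap psi phi ^+ 2 = c) (hc0 : 0 < c) (hc1 : c < 1) :
  let v_ee := ee_mse mu ket0 phi psi in
  let L (N : nat) : R :=
    (2 + c * (d%:R + 1) * (c * d%:R - 2) + 2 * c * (1 - c) * N%:R)
      / ((d%:R + N%:R) * (d%:R + N%:R + 1)) in
  [/\ forall M N : nat, (1 <= M)%N -> (1 <= N)%N ->
        v_ee M N =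
        ((d%:R + M%:R + N%:R)
           * ((2 + c * (c * d%:R - 2) * (d%:R + 1)) * (d%:R + M%:R + N%:R + 1)
              + 2 * c * (1 - c) * M%:R * N%:R)
         / ((d%:R + M%:R) * (d%:R + M%:R + 1)
            * (d%:R + N%:R) * (d%:R + N%:R + 1)))%:E,
      forall N : nat, (1 <= N)%N -> v_ee M N @[M --> \oo] --> (L N)%:E,
      L = (fun N : nat => 2 * c * (1 - c) / N%:R)
            +O_\oo (fun N : nat => N%:R ^- 2 : R)
    & forall (k : int) (Ms Ns : nat -> nat),
        (forall n, (Ms n)%:Z - (Ns n)%:Z = k) ->
        (Ms n + Ns n)%N @[n --> \oo] --> \oo ->
        (fun n => fine (v_ee (Ms n) (Ns n))) ~_\oo
        (fun n => 8 * c * (1 - c) / ((Ms n)%:R + (Ns n)%:R) : R)].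
Proof.
move=> v_ee L.
have d0 : (0 < d)%N by exact: ltn_trans hd.
have dR : 0 < d%:R :> R by rewrite ltr0n.
pose P : R := 2 + c * (c * d%:R - 2) * (d%:R + 1).
pose Q : R := 2 * c * (1 - c).
have vE M N : v_ee M N = (mse_rat d%:R P Q M%:R N%:R)%:E.
  by rewrite /v_ee (ee_mse_formula d0 hmu hket0 hphi hpsi) hc.
have LE : L = fun N => mse_lim d%:R P Q N%:R.
  by apply/funext => N; rewrite /L /mse_lim /P; congr (_ / _); rewrite /Q; ring.
split.
- by move=> M N _ _; rewrite vE.
- move=> N _; rewrite LE (funext (vE ^~ N)).
  by apply: cvg_EFin; [exact: nearW|exact: mse_rat_cvg].
- by rewrite LE; exact: mse_lim_bigO.
- move=> k Ms Ns hk hS.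
  have -> : (fun n => fine (v_ee (Ms n) (Ns n))) =
      (fun n => mse_rat d%:R P Q (Ms n)%:R (Ns n)%:R).
    by apply/funext => n; rewrite vE.
  have -> : (fun n => 8 * c * (1 - c) / ((Ms n)%:R + (Ns n)%:R) : R) =
      (fun n => 4 * Q / ((Ms n)%:R + (Ns n)%:R)).
    by apply/funext => n; rewrite /Q; congr (_ / _); ring.
  apply: (mse_rat_equiv _ dR (k := k%:~R)) => // [|n].
    (* Here 0 < c < 1 enters: it makes the leading coefficient Q nonzero. *)
    by rewrite /Q !mulf_neq0 ?pnatr_eq0 ?subr_eq0 ?gt_eqF.
  by rewrite -(hk n) rmorphB.
Qed.
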